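(* Let $f_1,\dots,f_N:\mathbb{R}^N\to\mathbb{R}$ be the players' cost functions. Suppose that each $f_i$ is a $\mathcal{C}^2$ function and that there exists a constant $m>0$ such that $(\mathbf{x}-\mathbf{z})^T(\bar{\mathcal{P}}(\mathbf{x})-\bar{\mathcal{P}}(\mathbf{z}))\ge m\|\mathbf{x}-\mathbf{z}\|^2$ for all $\mathbf{x},\mathbf{z}\in\mathbb{R}^N$, where $\bar{\mathcal{P}}(\mathbf{x})=[\nabla_1f_1(\mathbf{x}),\dots,\nabla_Nf_N(\mathbf{x})]^T$. Let $\bar U>0$. Then the Nash equilibrium $\mathbf{x}^*$ of the game is globally asymptotically stable under the saturated gradient play $$\dot x_i=-\rho_{\bar U}\big(\nabla_if_i(\mathbf{x})\big),\qquad i\in\{1,2,\dots,N\}.$$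
   Context: There is a game with $N$ players; player $i$ has action $x_i\in\mathbb{R}$ and cost function $f_i(\mathbf{x})$, $\mathbf{x}=[x_1,\dots,x_N]^T$. Also write $f_i(\mathbf{x})=f_i(x_i,\mathbf{x}_{-i})$ with $\mathbf{x}_{-i}=[x_1,\dots,x_{i-1},x_{i+1},\dots,x_N]^T$. Notation: $\nabla_if_i(\mathbf{x})=\frac{\partial f_i(\mathbf{x})}{\partial x_i}$. A Nash equilibrium is a point $\mathbf{x}^*=(x_i^*,\mathbf{x}_{-i}^* )\in\mathbb{R}^N$ such that $f_i(x_i^*,\mathbf{x}_{-i}^* )\le f_i(x_i,\mathbf{x}_{-i}^* )$ for all $x_i\in\mathbb{R}$ and all $i\in\{1,\dots,N\}$. (Under the stated monotonicity hypothesis the Nash equilibrium exists and is unique, and it is the unique zero of $\bar{\mathcal P}$.) The saturation function is $\rho_{\bar U}(\eta)=\mathrm{sgn}(\eta)\min\{|\eta|,\bar U\}$ for $\eta\in\mathbb{R}$. *)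

(* Defs.v *)
From HB Require Import structures.
From mathcomp Require Import all_boot all_order all_algebra.
From mathcomp Require Import all_classical all_reals all_analysis.

Set Implicit Arguments.
Unset Strict Implicit.
Unset Printing Implicit Defensive.

Import Order.TTheory GRing.Theory Num.Theory.
Import numFieldNormedType.Exports.

Local Open Scope classical_set_scope.
Local Open Scope ring_scope.

Definition dot (R : realType) (N : nat) (u v : 'rV[R]_N) : R :=
  (u *m v^T) 0 0.

(* The library norm on ['rV[R]_N] is the sup norm; this is the Euclidean one. *)
Definition enorm (R : realType) (N : nat) (u : 'rV[R]_N) : R :=
  Num.sqrt (dot u u).

Definition partial (R : realType) (N : nat) (i : 'I_N)
    (f : 'rV[R]_N -> R) (x : 'rV[R]_N) : R :=
  'D_(delta_mx 0 i) f x.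

(* [class_C k f]: all partial derivatives of [f] of order at most [k] exist
   everywhere and are continuous. *)
Fixpoint class_C (R : realType) (N : nat) (k : nat)
    (f : 'rV[R]_N -> R) : Prop :=
  continuous f /\
  match k with
  | 0%N => True
  | k'.+1 => forall i : 'I_N,
      (forall x, derivable f x (delta_mx 0 i)) /\ class_C k' (partial i f)
  end.

Definition pseudo_gradient (R : realType) (N : nat)
    (f : 'I_N -> 'rV[R]_N -> R) (x : 'rV[R]_N) : 'rV[R]_N :=
  \row_i partial i (f i) x.

Definition deviate (R : realType) (N : nat) (x : 'rV[R]_N) (i : 'I_N) (y : R) :
    'rV[R]_N :=
  \row_j (if j == i then y else x 0 j).

Definition nash_equilibrium (R : realType) (N : nat)
    (f : 'I_N -> 'rV[R]_N -> R) (x : 'rV[R]_N) : Prop :=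
  forall (i : 'I_N) (y : R), f i x <= f i (deviate x i y).

Definition saturation (R : realType) (U eta : R) : R :=
  Num.sg eta * Num.min `|eta| U.

Definition saturated_gradient_play (R : realType) (N : nat) (U : R)
    (f : 'I_N -> 'rV[R]_N -> R) (x : 'rV[R]_N) : 'rV[R]_N :=
  \row_i - saturation U (pseudo_gradient f x 0 i).

(* [x] solves x' = F(x) on [0, +oo[; its values at negative times are
   irrelevant.  For continuous [F], continuity of [x] at 0 together with the
   equation for t > 0 gives the one-sided equation at 0. *)
Definition solution (R : realType) (N : nat) (F : 'rV[R]_N -> 'rV[R]_N)
    (x : R -> 'rV[R]_N) : Prop :=
  {within `[0, +oo[, continuous x} /\
  forall t : R, 0 < t -> is_derive t (1 : R) x (F (x t)).

Definition lyapunov_stable (R : realType) (N : nat)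
    (F : 'rV[R]_N -> 'rV[R]_N) (xs : 'rV[R]_N) : Prop :=
  forall e : R, 0 < e -> exists2 d : R, 0 < d &
    forall x : R -> 'rV[R]_N, solution F x -> enorm (x 0 - xs) < d ->
      forall t : R, 0 <= t -> enorm (x t - xs) < e.

Definition globally_attractive (R : realType) (N : nat)
    (F : 'rV[R]_N -> 'rV[R]_N) (xs : 'rV[R]_N) : Prop :=
  forall x : R -> 'rV[R]_N, solution F x -> x t @[t --> +oo] --> xs.

(* The second clause makes explicit the usual presupposition that a trajectory
   exists for all t >= 0 from every initial state; without it the last two
   clauses could hold vacuously. *)
Definition globally_asymptotically_stable (R : realType) (N : nat)
    (F : 'rV[R]_N -> 'rV[R]_N) (xs : 'rV[R]_N) : Prop :=
  [/\ F xs = 0,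
      forall x0 : 'rV[R]_N, exists2 x, solution F x & x 0 = x0,
      lyapunov_stable F xs
    & globally_attractive F xs].

(* Main.v *)
Require Import Defs.
From mathcomp Require Import all_boot all_order all_algebra.
From mathcomp Require Import all_classical all_reals all_analysis.
From mathcomp Require Import ring lra.

Set Implicit Arguments.
Unset Strict Implicit.
Unset Printing Implicit Defensive.

Import Order.TTheory GRing.Theory Num.Theory.
Import numFieldNormedType.Exports.

Local Open Scope classical_set_scope.
Local Open Scope ring_scope.

(** Write [P] for the pseudo-gradient, [rho] for the saturation at level [U],
    and [m] for the monotonicity constant.  Everything rests on the Lyapunov
    function [V x = \sum_i H (P x)_i], where [H] is the primitive of [rho]
    vanishing at 0 (the Huber function: quadratic up to [U], affine beyond).

    Decay of [V].  Along a trajectory [x] put [u = P \o x]; it is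
    differentiable because [P] is C1.  Since [x' = - rho u], the chain rule
    gives [V' = rho u . u' = - x' . u'], and dividing the monotonicity
    inequality between times [t] and [t + h] by [h ^ 2] gives
    [x' . u' >= m (x' . x')] in the limit.  Hence [V' <= - m (rho u . rho u)],
    and [rho u . rho u >= min (U ^ 2) (2 V)]: either some coordinate is
    saturated, or [V] is exactly half the squared length of [u]
    ([energy_derive], [energy_saturation]).  As long as [V] stays above a
    positive level it decreases at least linearly, so it gets below every
    positive level ([energy_vanishes]).

    From [V] to distances.  Strong monotonicity makes [P] expand distances by
    at least [m], so two points where [V] is small are close to each other
    ([energy_close]).  This single fact gives the equilibrium, its stability
    and its attractivity: a trajectory is Cauchy as time grows, so it has a
    limit, and [V] vanishes there, that is, [P] does ([zero_of_trajectory]);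
    starting near a zero of [P] keeps [V] small forever
    ([zero_lyapunov_stable]); and every trajectory converges to the zero
    ([trajectory_cvg_zero]).  The existence of the equilibrium is thus a
    consequence of the dynamics.

    Trajectories.  The field [- rho (P x)] is bounded by [U] and, [P] being
    C1, Lipschitz on every ball.  Boundedness confines all Picard iterates up
    to time [T] to the ball of radius [U T], where a Lipschitz constant is
    available, so the iterates converge on the whole half-line at once
    ([bounded_lipschitz_solution]).

    Equilibria.  On a line parallel to the [i]-th axis monotonicity says that
    the derivative of [f i] is increasing, so critical points of the cost are
    minima, and Nash equilibria are the zeros of [P]
    ([nash_equilibrium_zero]). *)

(** * Vector-valued functions and their coordinates *)

Lemma row_norm_leP (R : realType) (N : nat) (u : 'rV[R]_N) (r : R) :
  0 <= r -> (`|u| <= r <-> forall j, `|u 0 j| <= r).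
Proof.
move=> r0; rewrite [`|u|](mx_normrE u); split.
  move=> /bigmax_leP[_ H] j; exact: (H (0, j)).
move=> H; apply/bigmax_leP; split=> // -[i j] _ /=.
by rewrite ord1.
Qed.

Lemma coord_norm_le (R : realType) (N : nat) (u : 'rV[R]_N) j :
  `|u 0 j| <= `|u|.
Proof. by apply: (row_norm_leP u (normr_ge0 u)).1. Qed.

Lemma is_derive_line (R : realType) (N : nat) (g : 'rV[R]_N -> R)
    (z v : 'rV[R]_N) (s : R) :
  derivable g (z + s *: v) v ->
  is_derive s (1 : R) (fun s : R => g (z + s *: v)) ('D_v g (z + s *: v)).
Proof.
have E : (fun h : R => h^-1 *: (((fun s => g (z + s *: v)) \o shift s) (h *: (1:R)) -
      g (z + s *: v))) =
    (fun h => h^-1 *: ((g \o shift (z + s *: v)) (h *: v) - g (z + s *: v))).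
  apply/funext => h /=; congr (_ *: (g _ - _)).
  by rewrite scaler1 scalerDl addrCA addrA addrC addrA.
move=> dg; split; first by rewrite /derivable E.
by rewrite /derive E.
Qed.

(** The order of the endpoints is left open because the lemma is applied to
    displacements of unknown sign. *)
Lemma MVT_between (R : realType) (f df : R -> R) (a b : R) :
  (forall x, is_derive x (1 : R) f (df x)) ->
  exists2 c, (a <= c <= b) || (b <= c <= a) & f b - f a = df c * (b - a).
Proof.
move=> fdf.
have cf A : {within A, continuous f}.
  apply: continuous_subspaceT => x; apply: differentiable_continuous.
  by apply/derivable1_diffP; exact: (fdf x).(@ex_derive _ _ _ _ _ _ _).
have [ab|/ltW ba] := leP a b.
  have [c cab E] := MVT_segment ab (fun x _ => fdf x) (cf _).
  by exists c => //; move: cab; rewrite in_itv /= => ->.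
have [c cab E] := MVT_segment ba (fun x _ => fdf x) (cf _).
exists c; first by move: cab; rewrite in_itv /= => ->; rewrite orbT.
by rewrite -opprB E -mulrN opprB.
Qed.

(** Move from [x] to [y] one coordinate at a time and apply the mean value
    theorem on each step.  The intermediate points have each coordinate between
    those of [x] and [y], hence lie in every sup-norm ball containing both: the
    ball centred at [x] gives the chain rule, a fixed ball gives the Lipschitz
    bound. *)
Lemma coordinatewise_MVT (R : realType) (N : nat) (g : 'rV[R]_N -> R)
    (x y : 'rV[R]_N) :
  (forall i z, derivable g z (delta_mx 0 i)) ->
  exists2 c : 'I_N -> 'rV[R]_N,
    forall i a r, `|x - a| <= r -> `|y - a| <= r -> `|c i - a| <= r &
    g y - g x = \sum_i partial i g (c i) * (y - x) 0 i.
Proof.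
move=> dg.
(* The first [k] coordinates come from [y], the others from [x]. *)
pose z k : 'rV[R]_N := \row_j (if (j < k)%N then y 0 j else x 0 j).
have zS (i : 'I_N) : z i.+1 = z i + (y - x) 0 i *: delta_mx 0 i.
  apply/rowP => j; rewrite !mxE eqxx /= ltnS leq_eqVlt.
  have [->|ji] := eqVneq j i; first by rewrite eqxx ltnn /= mulr1; lra.
  by rewrite (_ : (j == i :> nat) = false) ?mulr0 ?addr0 //; apply/negbTE.
have /choice[c Hc] (i : 'I_N) : exists c : 'rV[R]_N,
    (forall a r, `|x - a| <= r -> `|y - a| <= r -> `|c - a| <= r) /\
    g (z i.+1) - g (z i) = partial i g c * (y - x) 0 i.
  have [s sb E] := MVT_between 0 ((y - x) 0 i)
    (fun s => is_derive_line (dg i (z i + s *: delta_mx 0 i))).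
  exists (z i + s *: delta_mx 0 i); split; last first.
    by rewrite zS; move: E; rewrite scale0r addr0 subr0.
  move=> a r xr yr; have r0 : 0 <= r by apply: le_trans xr.
  apply/row_norm_leP => // j.
  have := (row_norm_leP _ r0).1 xr j.
  have := (row_norm_leP _ r0).1 yr j.
  move: sb; rewrite !mxE eqxx /=.
  have [->|ji] := eqVneq j i; last by rewrite mulr0 addr0; case: ifP.
  rewrite ltnn mulr1 !ler_norml; lra.
exists c => [i|]; first by case: (Hc i).
under eq_bigr do rewrite -(Hc _).2.
rewrite -(big_mkord xpredT (fun i => g (z i.+1) - g (z i))) telescope_sumr //.
congr (g _ - g _); apply/rowP => j; rewrite mxE ?ltn_ord //.
Qed.

Lemma is_derive1_quot (R : realType) (V : normedModType R) (f : R -> V) (t : R) (l : V) :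
  is_derive t 1 f l <-> h^-1 *: (f (h + t) - f t) @[h --> (0:R)^'] --> l.
Proof.
have E : (fun h : R => h^-1 *: ((f \o shift t) (h *: (1:R)) - f t)) =
  (fun h : R => h^-1 *: (f (h + t) - f t)).
  by apply/funext => h /=; rewrite scaler1.
split.
  by case; rewrite /derivable /derive E => cf <-.
move=> cf; split; first by rewrite /derivable E; exact: cvgP cf.
by rewrite /derive E; exact: cvg_lim cf.
Qed.

Lemma is_derive_continuous (R : realType) (V : normedModType R) (f : R -> V) (t : R) (l : V) :
  is_derive t 1 f l -> {for t, continuous f}.
Proof.
move=> [df _]; apply: differentiable_continuous; exact/derivable1_diffP.
Qed.

(** The chain rule, from [coordinatewise_MVT] applied between [x t] and
    [x (t + h)]: the intermediate points tend to [x t], where the partial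
    derivatives are continuous. *)
Lemma C1_curve (R : realType) (N : nat) (g : 'rV[R]_N -> R) (x : R -> 'rV[R]_N)
    (t : R) (v : 'rV[R]_N) :
  class_C 1 g -> is_derive t 1 x v ->
  is_derive t 1 (fun s => g (x s)) (\sum_i partial i g (x t) * v 0 i).
Proof.
move=> g1 dx; have /is_derive_continuous cx := dx.
have /choice[c Hc] (y : 'rV[R]_N) : exists c : 'I_N -> 'rV[R]_N,
    (forall i, `|c i - x t| <= `|y - x t|) /\
    g y - g (x t) = \sum_i partial i g (c i) * (y - x t) 0 i.
  have [c Hc E] := coordinatewise_MVT (x t) y (fun i => (g1.2 i).1).
  by exists c; split=> // i; apply: Hc => //; rewrite subrr normr0.
rewrite is_derive1_quot.
have -> : (fun h : R => h^-1 *: (g (x (h + t)) - g (x t))) = (fun h : R =>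
  \sum_i partial i g (c (x (h + t)) i) * (h^-1 *: (x (h + t) - x t)) 0 i).
  apply/funext => h; rewrite -[LHS]/(h^-1 * _) (Hc (x (h + t))).2.
  rewrite mulr_sumr; apply: eq_bigr => i _; rewrite !mxE; ring.
have xt : x (h + t) @[h --> 0^'] --> x t.
  exact: (continuous_withinNshiftx x t).2.
apply: cvg_big => [|i _]; first exact: add_continuous.
apply: cvgM; last first.
  move/is_derive1_quot: dx => dx.
  apply: (@cvg_comp _ _ _ (fun h : R => h^-1 *: (x (h + t) - x t))
    (fun M : 'rV[R]_N => M 0 i) _ (nbhs v) (nbhs (v 0 i)) dx).
  exact: coord_continuous.
apply: (@cvg_comp _ _ _ (fun h => c (x (h + t)) i) (partial i g) _ (nbhs (x t)) _).
  apply/cvgrPdist_le => e e0.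
  move/cvgrPdist_le : xt => /(_ e e0); apply: filterS => h xe.
  by rewrite distrC (le_trans ((Hc _).1 i)) // distrC.
exact: (g1.2 i).2.1.
Qed.

Lemma continuous_bounded_ball (R : realType) (N : nat) (g : 'rV[R]_N -> R)
    (a : 'rV[R]_N) (r : R) :
  continuous g -> exists2 K, 0 <= K & forall x, `|x - a| <= r -> `|g x| <= K.
Proof.
move=> cg.
have r1 : 0 < `|r| + 1 by rewrite ltr_wpDl.
have cA : compact (closed_ball a (`|r| + 1)).
  apply: bounded_closed_compact; last exact: closed_ball_closed.
  exists (`|a| + (`|r| + 1)); split => [|M ltM x]; first exact: num_real.
  rewrite closed_ballE // /closed_ball_ /= distrC => xr.
  rewrite -(subrK a x) (le_trans (ler_normD _ _))//; lra.
have /compact_bounded[M [Mr HM]] := continuous_compact (continuous_subspaceT cg) cA.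
exists (`|M| + 1) => [|x xr]; first by rewrite addr_ge0.
have xA : closed_ball a (`|r| + 1) x.
  rewrite closed_ballE // /closed_ball_ /= distrC (le_trans xr) //.
  by rewrite (le_trans (ler_norm r)) // lerDl.
apply: HM; last by exists x.
by rewrite ltr_pwDr // ler_norm.
Qed.

(** The partial derivatives are bounded on the ball, which is compact. *)
Lemma C1_lipschitz (R : realType) (N : nat) (g : 'rV[R]_N -> R)
    (a : 'rV[R]_N) (r : R) :
  class_C 1 g -> exists2 L, 0 <= L & forall x y, `|x - a| <= r -> `|y - a| <= r ->
    `|g y - g x| <= L * `|y - x|.
Proof.
move=> g1.
have /choice[K HK] (i : 'I_N) : exists K, 0 <= K /\
    forall x, `|x - a| <= r -> `|partial i g x| <= K.
  by have [K K0 HK] := continuous_bounded_ball a r (g1.2 i).2.1; exists K.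
exists (\sum_i K i); first by apply: sumr_ge0 => i _; exact: (HK i).1.
move=> x y xr yr; have [c Hc ->] := coordinatewise_MVT x y (fun i => (g1.2 i).1).
rewrite (le_trans (ler_norm_sum _ _ _)) // mulr_suml ler_sum // => i _.
by rewrite normrM ler_pM // ?coord_norm_le // (HK i).2 // Hc.
Qed.

(** * The saturation function and its primitive *)

(** Turns the defining product of a sign and a minimum into a form suited to
    case analysis. *)
Lemma saturation_clamp (R : realType) (U s : R) :
  0 < U -> saturation U s = Num.max (- U) (Num.min s U).
Proof.
move=> U0; rewrite /saturation.
have [s0|s0|->] := ltgtP s 0.
- rewrite ltr0_sg // ltr0_norm // mulN1r (@min_l _ _ s); last by lra.
  by case: (leP (- s) U) => ?; case: (leP (- U) s) => ?; lra.
- rewrite gtr0_sg // gtr0_norm // mul1r max_r //.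
  by case: (leP s U) => ?; lra.
- by rewrite sgr0 mul0r min_l ?max_r //; lra.
Qed.

Lemma saturation_le (R : realType) (U s : R) : 0 < U -> `|saturation U s| <= U.
Proof.
move=> U0; rewrite saturation_clamp // ler_norml.
by rewrite le_max lexx /= ge_max ge_min lexx orbT andbT; lra.
Qed.

Lemma saturation_lipschitz (R : realType) (U a b : R) : 0 < U ->
  `|saturation U b - saturation U a| <= `|b - a|.
Proof.
move=> U0; rewrite !saturation_clamp //.
rewrite ler_norml; have [ba|ba] := leP 0 (b - a);
  [rewrite [`|b - a|]ger0_norm //|rewrite [`|b - a|]ltr0_norm //];
  case: (leP a U) => ?; case: (leP b U) => ?;
  rewrite /Num.max; do 2 case: ltP => ?; (lra || (exfalso; lra)).
Qed.

(** The primitive of the saturation that vanishes at 0, in closed form: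
    [s ^ 2 / 2] when [`|s| <= U], and [U * `|s| - U ^ 2 / 2] otherwise. *)
Definition huber (R : realType) (U s : R) : R :=
  saturation U s * s - saturation U s ^+ 2 / 2.

Lemma huber_cases (R : realType) (U s : R) : 0 < U ->
  [\/ [/\ - U <= s, s <= U, saturation U s = s & huber U s = s ^+ 2 / 2],
      [/\ U < s, saturation U s = U & huber U s = U * s - U ^+ 2 / 2] |
      [/\ s < - U, saturation U s = - U & huber U s = - U * s - U ^+ 2 / 2]].
Proof.
move=> U0; rewrite /huber saturation_clamp //.
have [sU|Us] := leP s U; last by rewrite max_r; [apply: Or32; split; lra|lra].
have [Us'|sU'] := leP (- U) s; first by apply: Or31; split => //; lra.
by apply: Or33; split => //; lra.
Qed.

(** The Huber function is the convex conjugate of [p ^ 2 / 2] restricted to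
    [`|p| <= U], and the saturation of [s] is the slope [p] attaining the
    supremum. *)
Lemma huber_conjugate (R : realType) (U s p : R) : 0 < U -> `|p| <= U ->
  p * s - p ^+ 2 / 2 <= huber U s.
Proof.
move=> U0; rewrite ler_norml => /andP[Up pU].
have [[_ _ _ ->]|[Us _ ->]|[sU _ ->]] := huber_cases s U0.
- by have := sqr_ge0 (s - p); lra.
- have := sqr_ge0 (U - p).
  have : 0 <= (U - p) * (s - U) by apply: mulr_ge0; lra.
  lra.
- have := sqr_ge0 (U + p).
  have : 0 <= (U + p) * (- s - U) by apply: mulr_ge0; lra.
  lra.
Qed.

(** Both bounds are instances of [huber_conjugate], with the slope taken at
    one end and the point at the other; the upper one also uses that the
    saturation is 1-Lipschitz. *)
Lemma huber_taylor (R : realType) (U a b : R) : 0 < U ->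
  0 <= huber U b - huber U a - saturation U a * (b - a) <= (b - a) ^+ 2.
Proof.
move=> U0; have Ha := huber_conjugate b U0 (saturation_le a U0).
have Hb := huber_conjugate a U0 (saturation_le b U0).
have L : (saturation U b - saturation U a) * (b - a) <= (b - a) ^+ 2.
  rewrite (le_trans (ler_norm _)) // normrM -[leRHS]real_normK ?num_real //.
  by rewrite expr2 ler_wpM2r // saturation_lipschitz.
rewrite /huber in Ha Hb *; lra.
Qed.

Lemma huber_ge0 (R : realType) (U s : R) : 0 < U -> 0 <= huber U s.
Proof.
by move=> U0; have [[? ? _ ->]|[? _ ->]|[? _ ->]] := huber_cases s U0; nra.
Qed.

Lemma huber_is_derive (R : realType) (U a : R) : 0 < U ->
  is_derive a (1 : R) (huber U) (saturation U a).
Proof.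
move=> U0; apply/is_derive1_quot/cvgrPdist_le => e e0.
near=> h.
have h0 : h != 0 by near: h; exact: nbhs_dnbhs_neq.
have he : `|h| < e by near: h; apply: dnbhs0_lt.
have := huber_taylor a (h + a) U0; rewrite addrK => /andP[H0 H].
have -> : saturation U a - h^-1 *: (huber U (h + a) - huber U a) =
  - h^-1 * (huber U (h + a) - huber U a - saturation U a * h).
  by rewrite /GRing.scale /=; field.
rewrite normrM normrN normfV ler_pdivrMl ?normr_gt0 // ger0_norm //.
rewrite (le_trans H) // -real_normK ?num_real // expr2 ler_wpM2l // ltW //.
Unshelve. all: by end_near. Qed.

(** The Lyapunov function, as a function of the value of the pseudo-gradient. *)
Definition energy (R : realType) (N : nat) (U : R) (y : 'rV[R]_N) : R :=
  \sum_i huber U (y 0 i).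

Lemma dotE (R : realType) (N : nat) (u v : 'rV[R]_N) :
  dot u v = \sum_i u 0 i * v 0 i.
Proof. by rewrite /dot mxE; apply: eq_bigr => i _; rewrite mxE. Qed.

Lemma energy_ge0 (R : realType) (N : nat) (U : R) (y : 'rV[R]_N) :
  0 < U -> 0 <= energy U y.
Proof. by move=> U0; apply: sumr_ge0 => i _; exact: huber_ge0. Qed.

(** If the energy is below [U ^ 2 / 2] then so is each of its terms, so no
    coordinate is saturated and each term is in its quadratic regime. *)
Lemma energy_small (R : realType) (N : nat) (U : R) (y : 'rV[R]_N) :
  0 < U -> 2 * energy U y < U ^+ 2 -> dot y y = 2 * energy U y.
Proof.
move=> U0 yU; rewrite dotE mulr_sumr; apply: eq_bigr => i _.
have : huber U (y 0 i) <= energy U y.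
  rewrite /energy (bigD1 i) //= lerDl sumr_ge0 // => j _; exact: huber_ge0.
by have [[? ? _ ->]|[? _ ->]|[? _ ->]] := huber_cases (y 0 i) U0; nra.
Qed.

(** A saturated coordinate contributes [U ^ 2] on its own; without any, the
    two sides are both the squared length of [y]. *)
Lemma energy_saturation (R : realType) (N : nat) (U : R) (y : 'rV[R]_N) :
  0 < U ->
  Num.min (U ^+ 2) (2 * energy U y) <= \sum_i saturation U (y 0 i) ^+ 2.
Proof.
move=> U0; have [[i Ui]|nU] := pselect (exists i, U < `|y 0 i|).
  rewrite ge_min; apply/orP; left; rewrite (bigD1 i) //=.
  rewrite -[leLHS]addr0 lerD //; last by apply: sumr_ge0 => j _; exact: sqr_ge0.
  move: Ui; rewrite ltr_normr.
  by have [[? ? -> _]|[? -> _]|[? -> _]] := huber_cases (y 0 i) U0; nra.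
rewrite ge_min; apply/orP; right; rewrite mulr_sumr; apply: ler_sum => i _.
have : `|y 0 i| <= U by rewrite leNgt; apply/negP => ?; apply: nU; exists i.
rewrite ler_norml => /andP[? ?].
by have [[? ? -> ->]|[? -> ->]|[? -> ->]] := huber_cases (y 0 i) U0; nra.
Qed.

(** * Derivatives of curves *)

Lemma cvg_dot (R : realType) (N : nat) (T : Type) (F : set_system T) {FF : Filter F}
    (a b : T -> 'rV[R]_N) (v w : 'rV[R]_N) :
  (forall i, a h 0 i @[h --> F] --> v 0 i) ->
  (forall i, b h 0 i @[h --> F] --> w 0 i) ->
  dot (a h) (b h) @[h --> F] --> dot v w.
Proof.
move=> av bw; rewrite dotE; under eq_cvg do rewrite dotE.
apply: cvg_big => [|i _]; first exact: add_continuous.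
exact: cvgM.
Qed.

Lemma is_derive_coord (R : realType) (N : nat) (x : R -> 'rV[R]_N) (t : R) v i :
  is_derive t (1 : R) x v -> is_derive t (1 : R) (fun s => x s 0 i) (v 0 i).
Proof.
move/is_derive1_quot => dx; apply/is_derive1_quot.
have -> : (fun h : R => h^-1 *: (x (h + t) 0 i - x t 0 i)) =
    (fun h => (h^-1 *: (x (h + t) - x t)) 0 i).
  by apply/funext => h; rewrite !mxE.
apply: (@cvg_comp _ _ _ (fun h : R => h^-1 *: (x (h + t) - x t))
    (fun M : 'rV[R]_N => M 0 i) _ (nbhs v) (nbhs (v 0 i)) dx).
exact: coord_continuous.
Qed.

(** The infinitesimal form of monotonicity along a curve: divide the
    inequality between times [t] and [t + h] by [h ^ 2] and let [h] tend to 0.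
    Working along the curve avoids the Jacobian of the monotone map. *)
Lemma derive_monotone (R : realType) (N : nat) (x u : R -> 'rV[R]_N) (t m : R)
    (v w : 'rV[R]_N) :
  (forall s, m * dot (x s - x t) (x s - x t) <= dot (x s - x t) (u s - u t)) ->
  (forall i, is_derive t (1 : R) (fun s => x s 0 i) (v 0 i)) ->
  (forall i, is_derive t (1 : R) (fun s => u s 0 i) (w 0 i)) ->
  m * dot v v <= dot v w.
Proof.
move=> mono dx du.
pose q (z : R -> 'rV[R]_N) (h : R) := h^-1 *: (z (h + t) - z t).
have qE (z : R -> 'rV[R]_N) (y : 'rV[R]_N) : (forall i, is_derive t (1 : R) (fun s => z s 0 i) (y 0 i)) ->
    forall i, q z h 0 i @[h --> (0:R)^'] --> y 0 i.
  move=> dz i; move/is_derive1_quot : (dz i).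
  have <- // : (fun h => q z h 0 i) =
      (fun h => h^-1 *: (z (h + t) 0 i - z t 0 i)).
  by apply/funext => h; rewrite !mxE.
have xv := qE _ _ dx; have uw := qE _ _ du.
have L : dot (q x h) (q u h) @[h --> (0:R)^'] --> dot v w by exact: cvg_dot.
have L' : m * dot (q x h) (q x h) @[h --> (0:R)^'] --> m * dot v v.
  by apply: cvgM; [exact: cvg_cst|exact: cvg_dot].
apply: (ler_cvg_to L' L); apply: nearW => h.
have dotZ (c : R) (a b : 'rV[R]_N) : dot (c *: a) (c *: b) = c ^+ 2 * dot a b.
  by rewrite !dotE mulr_sumr; apply: eq_bigr => i _; rewrite !mxE; ring.
by rewrite /q !dotZ mulrCA ler_wpM2l // sqr_ge0.
Qed.

Lemma growth_le (R : realType) (phi : R -> R) (s t k : R) :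
  s <= t -> {within `[s, t], continuous phi} ->
  (forall r, s < r < t -> exists2 d, is_derive r (1:R) phi d & d <= k) ->
  phi t <= phi s + k * (t - s).
Proof.
move=> st cphi dphi.
have H r : r \in `]s, t[%R -> is_derive r (1:R) phi ('D_1 phi r) /\ 'D_1 phi r <= k.
  rewrite in_itv => /dphi[d [dd dE] dk].
  by split; [exact/derivableP|rewrite dE].
move: st; rewrite le_eqVlt => /orP[/eqP ->|st]; first by rewrite subrr mulr0 addr0.
have [r rst E] := MVT st (fun r rst => (H r rst).1) cphi.
rewrite -lerBlDl E ler_wpM2r ?subr_ge0 ?(ltW st) //; exact: (H r rst).2.
Qed.

(** * Decay of the Lyapunov function along trajectories *)

Definition strongly_monotone (R : realType) (N : nat) (m : R)
    (P : 'rV[R]_N -> 'rV[R]_N) : Prop :=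
  forall x z, m * dot (x - z) (x - z) <= dot (x - z) (P x - P z).

Definition saturated_field (R : realType) (N : nat) (U : R)
    (P : 'rV[R]_N -> 'rV[R]_N) (x : 'rV[R]_N) : 'rV[R]_N :=
  \row_i - saturation U (P x 0 i).

(** Expand [0 <= dot (w - m d) (w - m d)] for [d = x - z] and
    [w = P x - P z], and bound the cross term by monotonicity. *)
Lemma strongly_monotone_expansive (R : realType) (N : nat) (m : R)
    (P : 'rV[R]_N -> 'rV[R]_N) (x z : 'rV[R]_N) :
  0 < m -> strongly_monotone m P ->
  m ^+ 2 * dot (x - z) (x - z) <= dot (P x - P z) (P x - P z).
Proof.
move=> m0 /(_ x z); move: (x - z) (P x - P z) => d w dw.
have : 0 <= dot (w - m *: d) (w - m *: d).
  by rewrite dotE; apply: sumr_ge0 => i _; rewrite -expr2 sqr_ge0.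
have -> : dot (w - m *: d) (w - m *: d) =
    dot w w - 2 * m * dot d w + m ^+ 2 * dot d d.
  rewrite !dotE !mulr_sumr -sumrB -big_split /=; apply: eq_bigr => i _.
  by rewrite !mxE; ring.
move: dw; rewrite -(ler_pM2l m0); lra.
Qed.

Section trajectories.
Context (R : realType) (N : nat) (m U : R) (P : 'rV[R]_N -> 'rV[R]_N).
Hypotheses (m0 : 0 < m) (U0 : 0 < U).
Hypothesis P1 : forall i, class_C 1 (fun x => P x 0 i).
Hypothesis mono : strongly_monotone m P.

Let V x := energy U (P x).

Lemma energy_continuous : continuous V.
Proof.
apply: (@continuous_big R _ +%R 0 xpredT add_continuous 'rV[R]_N _
  (fun i x => huber U (P x 0 i))) => i _ x.
apply: (@continuous_comp _ _ _ (fun x => P x 0 i) (huber U)); first exact: (P1 i).1.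
exact: is_derive_continuous (huber_is_derive _ U0).
Qed.

Variable x : R -> 'rV[R]_N.
Hypothesis sol : solution (saturated_field U P) x.

(** With [v = x'] and [w] the derivative of [P \o x], the chain rule gives
    [- dot v w] because [v] is minus the saturation of [P x]; then
    [derive_monotone] and [energy_saturation] bound it. *)
Lemma energy_derive (t : R) : 0 < t -> exists2 d,
  is_derive t (1 : R) (fun s => V (x s)) d &
  d <= - (m * Num.min (U ^+ 2) (2 * V (x t))).
Proof.
move=> t0; have dx := sol.2 t t0.
pose v := saturated_field U P (x t).
have dP i := C1_curve (P1 i) dx.
pose w : 'rV[R]_N := \row_i \sum_j partial j (fun x => P x 0 i) (x t) * v 0 j.
exists (- dot v w).
  have -> : - dot v w = \sum_i saturation U (P (x t) 0 i) * w 0 i.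
    by rewrite dotE -sumrN; apply: eq_bigr => i _; rewrite !mxE mulNr opprK.
  have -> : (fun s => V (x s)) = \sum_i (huber U \o (fun s => P (x s) 0 i)).
    by apply/funext => s; rewrite fct_sumE.
  apply: is_derive_sum => i; apply: is_derive1_comp.
    exact: huber_is_derive.
  by rewrite mxE.
rewrite lerN2; have := @derive_monotone _ _ x (P \o x) t m v w (fun s => mono _ _).
move=> /(_ (fun i => is_derive_coord i dx)) le_vw.
have {le_vw} : m * dot v v <= dot v w by apply: le_vw => i; rewrite mxE.
apply: le_trans; rewrite ler_pM2l //.
have -> : dot v v = \sum_i saturation U (P (x t) 0 i) ^+ 2.
  by rewrite dotE; apply: eq_bigr => i _; rewrite !mxE mulrNN.
exact: energy_saturation.
Qed.

Lemma energy_trajectory_continuous (s t : R) : 0 <= s ->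
  {within `[s, t], continuous (fun r => V (x r))}.
Proof.
move=> s0.
have cx : {within `[s, t], continuous x}.
  apply: continuous_subspaceW sol.1 => r /=.
  by rewrite !in_itv /= andbT => /andP[sr _]; exact: le_trans sr.
move=> r; apply: (@continuous_comp _ _ _ (x : subspace _ -> _) V); first exact: cx.
exact: energy_continuous.
Qed.

Lemma energy_decay (s t k : R) : 0 <= s <= t ->
  (forall r, s < r < t -> k <= m * Num.min (U ^+ 2) (2 * V (x r))) ->
  V (x t) <= V (x s) - k * (t - s).
Proof.
move=> /andP[s0 st] Hk; rewrite -mulNr.
apply: (growth_le (phi := fun r => V (x r))) => //.
  exact: energy_trajectory_continuous.
move=> r srt; have [sr rt] := andP srt.
have [d dd dle] := energy_derive (le_lt_trans s0 sr).
by exists d => //; rewrite (le_trans dle) // lerN2 Hk.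
Qed.

Lemma energy_nonincreasing (s t : R) : 0 <= s <= t -> V (x t) <= V (x s).
Proof.
move=> st; have := energy_decay (k := 0) st; rewrite mul0r subr0; apply => r _.
by rewrite mulr_ge0 ?(ltW m0) // le_min sqr_ge0 mulr_ge0 // energy_ge0.
Qed.

(** Otherwise the energy would decrease at a fixed positive rate forever and
    become negative. *)
Lemma energy_vanishes (v : R) : 0 < v -> exists2 t, 0 <= t & V (x t) < v.
Proof.
move=> v0; apply: contrapT => H.
have Hv t : 0 <= t -> v <= V (x t).
  by move=> t0; rewrite leNgt; apply/negP => ?; apply: H; exists t.
pose k := m * Num.min (U ^+ 2) (2 * v).
have k0 : 0 < k by rewrite mulr_gt0 // lt_min exprn_gt0 // mulr_gt0.
(* At time [T] the linear upper bound on the energy reaches 0. *)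
pose T := V (x 0) / k.
have T0 : 0 <= T by rewrite divr_ge0 ?energy_ge0 // ltW.
have := Hv T T0; apply/negP; rewrite -ltNge.
apply: le_lt_trans v0.
rewrite (le_trans (energy_decay (s := 0) (t := T) (k := k) _ _)) ?lexx //.
  move=> r /andP[r0 _]; rewrite ler_pM2l // le_min !ge_min lexx /= ler_pM2l //.
  by rewrite Hv ?orbT // ltW.
by rewrite /T subr0 mulrC divfK ?subrr // gt_eqF.
Qed.

End trajectories.

(** * Zeros of the pseudo-gradient, stability and attractivity *)

Lemma dot_ge0 (R : realType) (N : nat) (u : 'rV[R]_N) : 0 <= dot u u.
Proof. by rewrite dotE; apply: sumr_ge0 => i _; rewrite -expr2 sqr_ge0. Qed.

Lemma enorm_sqr (R : realType) (N : nat) (u : 'rV[R]_N) : enorm u ^+ 2 = dot u u.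
Proof. by rewrite sqr_sqrtr // dot_ge0. Qed.

Lemma norm_le_enorm (R : realType) (N : nat) (u : 'rV[R]_N) : `|u| <= enorm u.
Proof.
apply/row_norm_leP => [|j]; first exact: sqrtr_ge0.
rewrite -ler_sqr ?nnegrE ?sqrtr_ge0 // enorm_sqr real_normK ?num_real // dotE.
rewrite (bigD1 j) //= -expr2 lerDl sumr_ge0 // => i _.
by rewrite -expr2 sqr_ge0.
Qed.

Section equilibrium.
Context (R : realType) (N : nat) (m U : R) (P : 'rV[R]_N -> 'rV[R]_N).
Hypotheses (m0 : 0 < m) (U0 : 0 < U).
Hypothesis P1 : forall i, class_C 1 (fun x => P x 0 i).
Hypothesis mono : strongly_monotone m P.

Let V x := energy U (P x).

(** Where the energy is small it is half the squared length of [P]; hence [P a]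
    and [P b] are both short, and [P] expands distances. *)
Lemma energy_close (e : R) : 0 < e -> exists2 w, 0 < w &
  forall a b, V a < w -> V b < w -> enorm (a - b) < e.
Proof.
move=> e0.
(* The first bound keeps both points in the quadratic regime.  The second gives
   [m ^ 2 * enorm (a - b) ^ 2 < 8 w <= m ^ 2 * e ^ 2], the squared length of
   [P a - P b] being at most twice the sum of those of [P a] and [P b]. *)
pose w := Num.min (U ^+ 2) (m ^+ 2 * e ^+ 2 / 4) / 2.
have w0 : 0 < w.
  by rewrite divr_gt0 // lt_min exprn_gt0 //= divr_gt0 // mulr_gt0 // exprn_gt0.
have wU : 2 * w <= U ^+ 2 by rewrite /w mulrC divfK // ge_min lexx.
have we : 2 * w <= m ^+ 2 * e ^+ 2 / 4.
  by rewrite /w mulrC divfK // ge_min lexx orbT.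
exists w => // a b aw bw.
have Pa : dot (P a) (P a) < 2 * w.
  by rewrite (energy_small U0) ?ltr_pM2l // (lt_le_trans _ wU) // ltr_pM2l.
have Pb : dot (P b) (P b) < 2 * w.
  by rewrite (energy_small U0) ?ltr_pM2l // (lt_le_trans _ wU) // ltr_pM2l.
have Pab : dot (P a - P b) (P a - P b) <=
    2 * dot (P a) (P a) + 2 * dot (P b) (P b).
  have -> : 2 * dot (P a) (P a) + 2 * dot (P b) (P b) =
      dot (P a - P b) (P a - P b) + dot (P a + P b) (P a + P b).
    rewrite !dotE !mulr_sumr -!big_split /=; apply: eq_bigr => i _.
    by rewrite !mxE; ring.
  by rewrite lerDl dot_ge0.
have := strongly_monotone_expansive a b m0 mono.
rewrite -ltr_sqr ?nnegrE ?sqrtr_ge0 ?(ltW e0) // enorm_sqr => ab.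
have m20 : 0 < m ^+ 2 by rewrite exprn_gt0.
rewrite -(ltr_pM2l m20); lra.
Qed.

Lemma energy_eq0 (z : 'rV[R]_N) : V z = 0 <-> P z = 0.
Proof.
split=> Pz; last first.
  rewrite /V /energy Pz big1 // => i _.
  by rewrite mxE /huber mulr0 /saturation sgr0 mul0r expr0n /= mul0r subrr.
have := @energy_small R N U (P z) U0; rewrite -/(V z) Pz mulr0 exprn_gt0 //.
move=> /(_ isT); rewrite dotE => /eqP; rewrite psumr_eq0; last first.
  by move=> i _; rewrite -expr2 sqr_ge0.
move=> /allP Pz0; apply/rowP => i; rewrite mxE.
by have := Pz0 i (mem_index_enum _); rewrite mulf_eq0 orbb => /eqP.
Qed.

(** The common core of the convergence statements: from time [t0] on, the
    trajectory is close to any point of low energy, be it one of its own points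
    (whence the Cauchy property) or a zero of [P]. *)
Lemma trajectory_eventually_close (x : R -> 'rV[R]_N) (e : R) :
  solution (saturated_field U P) x -> 0 < e ->
  exists2 w, 0 < w & exists2 t0, 0 <= t0 &
    V (x t0) < w /\ forall a t, V a < w -> t0 <= t -> `|a - x t| < e.
Proof.
move=> sol e0; have [w w0 Hw] := energy_close e0.
exists w => //; have [t0 t00 Vt0] := energy_vanishes m0 U0 P1 mono sol w0.
exists t0 => //; split=> // a t aw t0t.
rewrite (le_lt_trans (norm_le_enorm _)) // Hw //.
by apply: le_lt_trans Vt0; apply: (energy_nonincreasing m0 U0 P1 mono sol);
  rewrite t00.
Qed.

Lemma trajectory_cvg_zero (x : R -> 'rV[R]_N) (z : 'rV[R]_N) :
  solution (saturated_field U P) x -> P z = 0 -> x t @[t --> +oo] --> z.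
Proof.
move=> sol /energy_eq0 Vz; apply/cvgrPdist_lt => e e0.
have [w w0 [t0 _ [_ H]]] := trajectory_eventually_close sol e0.
near=> t; apply: H; first by rewrite Vz.
by near: t; apply: nbhs_pinfty_ge; exact: num_real.
Unshelve. all: by end_near. Qed.

(** The trajectory is Cauchy, and its limit has zero energy by continuity. *)
Lemma zero_of_trajectory (x : R -> 'rV[R]_N) :
  solution (saturated_field U P) x -> exists z, P z = 0.
Proof.
move=> sol.
have cx : cvg (x t @[t --> +oo]).
  apply/cauchy_cvgP/cauchy_exP => e e0.
  have [w w0 [t0 _ [Vt0 H]]] := trajectory_eventually_close sol e0.
  exists (x t0); suff : \forall t \near +oo, ball (x t0) e (x t) by [].
  apply: filterS (nbhs_pinfty_ge (num_real t0)) => t t0t.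
  by rewrite -ball_normE /=; apply: H.
pose z := lim (x t @[t --> +oo]).
have Vx : V (x t) @[t --> +oo] --> V z.
  apply: (@cvg_comp _ _ _ x V _ (nbhs z) (nbhs (V z))); first exact: cx.
  exact: energy_continuous.
exists z; apply/energy_eq0/eqP; rewrite eq_le energy_ge0 // andbT leNgt.
apply/negP => Vz0.
have Vz2 : 0 < V z / 2 by rewrite divr_gt0.
have [t0 t00 Vt0] := energy_vanishes m0 U0 P1 mono sol Vz2.
suff : V z <= V z / 2 by lra.
apply: (ler_cvg_to Vx (cvg_cst (V z / 2))).
near=> t; apply: (le_trans _ (ltW Vt0)).
apply: (energy_nonincreasing m0 U0 P1 mono sol); rewrite t00 /=.
by near: t; apply: nbhs_pinfty_ge; exact: num_real.
Unshelve. all: by end_near. Qed.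

Lemma zero_lyapunov_stable (z : 'rV[R]_N) :
  P z = 0 -> lyapunov_stable (saturated_field U P) z.
Proof.
move=> /energy_eq0 Vz e e0; have [w w0 Hw] := energy_close e0.
have /cvgrPdist_lt/(_ w w0)/nbhs_ballP[d d0 Hd] :=
  @energy_continuous _ _ _ _ U0 P1 z.
exists d => // x sol xd t t0; apply: Hw; last by rewrite Vz.
apply: le_lt_trans (energy_nonincreasing m0 U0 P1 mono sol (s := 0) _) _.
  by rewrite lexx.
have /= := Hd (x 0); rewrite -/(V z) Vz sub0r normrN => /(_ _)/(le_lt_trans (ler_norm _)).
apply; rewrite -ball_normE /= distrC.
exact: le_lt_trans (norm_le_enorm _) xd.
Qed.

End equilibrium.

(** * Nash equilibria as zeros of the pseudo-gradient *)

Lemma deviateE (R : realType) (N : nat) (x : 'rV[R]_N) (i : 'I_N) (y : R) :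
  deviate x i y = x + (y - x 0 i) *: delta_mx 0 i.
Proof.
apply/rowP => j; rewrite !mxE eqxx /=; have [->|_] := eqVneq j i.
  by rewrite mulr1 addrC subrK.
by rewrite mulr0 addr0.
Qed.

(** Strong monotonicity between two points that differ in one coordinate only
    involves the corresponding component of [P] only. *)
Lemma strongly_monotone_axis (R : realType) (N : nat) (m : R)
    (P : 'rV[R]_N -> 'rV[R]_N) (x : 'rV[R]_N) (i : 'I_N) (s : R) :
  strongly_monotone m P ->
  m * s ^+ 2 <= s * (P (x + s *: delta_mx 0 i) 0 i - P x 0 i).
Proof.
move=> /(_ (x + s *: delta_mx 0 i) x); rewrite addrAC subrr add0r !dotE.
rewrite (bigD1 i) //= big1 => [|j /negbTE ji]; last first.
  by rewrite !mxE ji mulr0 mul0r.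
rewrite (bigD1 i) //= big1 => [|j /negbTE ji]; last first.
  by rewrite !mxE ji mulr0 mul0r.
by rewrite !mxE !eqxx mulr1 !addr0 expr2.
Qed.

(** At a Nash equilibrium each partial derivative vanishes by Fermat's rule.
    Conversely, if [P x = 0], then by [strongly_monotone_axis] the derivative of
    [f i] along the [i]-th axis has the sign of the displacement from [x]. *)
Lemma nash_equilibrium_zero (R : realType) (N : nat) (m : R)
    (f : 'I_N -> 'rV[R]_N -> R) (x : 'rV[R]_N) :
  0 < m -> (forall i, class_C 1 (f i)) ->
  strongly_monotone m (pseudo_gradient f) ->
  nash_equilibrium f x <-> pseudo_gradient f x = 0.
Proof.
move=> m0 f1 mono.
have dline i s := is_derive_line (((f1 i).2 i).1 (x + s *: delta_mx 0 i)).
split=> [nash|Px i y].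
  apply/rowP => i; rewrite !mxE; have [d0 d0E] := dline i 0.
  have : is_derive (0:R) (1:R) (fun s => f i (x + s *: delta_mx 0 i)) 0.
    apply: (@derive1_at_min _ _ (-1) 1).
    - lra.
    - by move=> s _; exact: (dline i s).(@ex_derive _ _ _ _ _ _ _).
    - by rewrite in_itv /=; lra.
    - move=> s _; have := nash i (s + x 0 i).
      by rewrite deviateE addrK scale0r addr0.
  move=> [_]; rewrite d0E scale0r addr0; exact.
rewrite deviateE; set d := y - x 0 i.
have [c cd E] := MVT_between 0 d (dline i).
move: E; rewrite scale0r addr0 subr0 => E; rewrite -subr_ge0 E.
have := strongly_monotone_axis x i c mono; rewrite Px !mxE subr0.
rewrite -/(partial i (f i) _); set p := partial _ _ _ => cp.
have {cp} cp : 0 <= c * p by apply: le_trans cp; rewrite mulr_ge0 ?sqr_ge0 // ltW.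
have [c0|c0] := eqVneq c 0.
  suff -> : p = 0 by rewrite mul0r.
  by move/rowP : Px => /(_ i); rewrite !mxE /p c0 scale0r addr0.
(* [c] lies between 0 and [d], so [d / c] is nonnegative. *)
have -> : p * d = (c * p) * (d / c) by field.
apply: mulr_ge0 => //.
have [c_gt0|c_lt0|cE] := ltgtP 0 c; last by rewrite -cE eqxx in c0.
  by apply: divr_ge0; lra.
by rewrite -mulrNN -invrN; apply: divr_ge0; lra.
Qed.

(** * Primitives of continuous functions *)

Lemma cvg_row (R : realType) (N : nat) (T : Type) (F : set_system T)
    {FF : Filter F} (a : T -> 'rV[R]_N) (v : 'rV[R]_N) :
  (forall i, a h 0 i @[h --> F] --> v 0 i) -> a h @[h --> F] --> v.
Proof.
move=> av; apply/cvgrPdist_le => e e0.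
have : \forall h \near F, forall i, `|v 0 i - a h 0 i| <= e.
  apply: filter_forall => i; by move/cvgrPdist_le : (av i); exact.
apply: filterS => h H; apply/row_norm_leP; first exact: ltW.
by move=> j; rewrite !mxE; exact: H.
Qed.

Lemma is_derive_row (R : realType) (N : nat) (x : R -> 'rV[R]_N) (t : R)
    (v : 'rV[R]_N) :
  (forall i, is_derive t (1 : R) (fun s => x s 0 i) (v 0 i)) ->
  is_derive t (1 : R) x v.
Proof.
move=> dx; apply/is_derive1_quot; apply: cvg_row => i.
move/is_derive1_quot : (dx i).
have <- // : (fun h => (h^-1 *: (x (h + t) - x t)) 0 i) =
    (fun h => h^-1 *: (x (h + t) 0 i - x t 0 i)).
by apply/funext => h; rewrite !mxE.
Qed.

(** The integral starts at -1 so that 0 is an interior point and the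
    derivative exists there too. *)
Definition primitive (R : realType) (g : R -> R) (t : R) : R :=
  (\int[lebesgue_measure]_(s in `[(-1)%R, t]) g s)%R -
  (\int[lebesgue_measure]_(s in `[(-1)%R, 0%R]) g s)%R.

Lemma primitive0 (R : realType) (g : R -> R) : primitive g 0 = 0.
Proof. by rewrite /primitive subrr. Qed.

Lemma primitive_is_derive (R : realType) (g : R -> R) (t : R) :
  continuous g -> 0 <= t -> is_derive t (1 : R) (primitive g) (g t).
Proof.
move=> cg t0.
have tt1 : t < t + 1 by rewrite ltrDl.
have gi : lebesgue_measure.-integrable `[-1, t + 1] (EFin \o g).
  apply: continuous_compact_integrable; first exact: segment_compact.
  exact: continuous_subspaceT.
have [d dE] := continuous_FTC1_closed tt1 gi (lt_le_trans (ltrN10 R) t0) (cg t).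
rewrite -[X in is_derive _ _ _ X]subr0; apply: is_deriveB.
by split; [exact: d|rewrite -derive1E dE].
Qed.

(** Bounding an integral by a bound on the integrand, in differential form: it
    is the only estimate on integrals that the Picard iteration needs. *)
Lemma norm_growth_le (R : realType) (phi g B b : R -> R) (t : R) :
  0 <= t ->
  (forall s, 0 <= s <= t -> is_derive s (1 : R) phi (g s)) ->
  (forall s, 0 <= s <= t -> is_derive s (1 : R) B (b s)) ->
  (forall s, 0 <= s <= t -> `|g s| <= b s) ->
  `|phi t - phi 0| <= B t - B 0.
Proof.
move=> t0 dphi dB gb.
have H (psi : R -> R) h : (forall s, 0 <= s <= t -> is_derive s (1 : R) psi (h s)) ->
    (forall s, 0 <= s <= t -> h s <= b s) -> psi t - psi 0 <= B t - B 0.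
  move=> dpsi hb.
  have d s : 0 <= s <= t -> is_derive s (1 : R) (psi - B) (h s - b s).
    by move=> st; apply: is_deriveB; [exact: dpsi|exact: dB].
  have : psi t - B t <= psi 0 - B 0 + 0 * (t - 0).
    apply: (@growth_le R (psi - B)) => //.
      apply: derivable_within_continuous => s; rewrite in_itv /= => st.
      exact: (d s st).(@ex_derive _ _ _ _ _ _ _).
    move=> s /andP[s0 st]; exists (h s - b s); first by apply: d; rewrite !ltW.
    by rewrite subr_le0 hb // !ltW.
  lra.
rewrite ler_norml; apply/andP; split.
  have : (- phi) t - (- phi) 0 <= B t - B 0.
    apply: (H (- phi) (fun s => - g s)) => s st; first exact: is_deriveN (dphi s st).
    by apply: le_trans (gb s st); rewrite -normrN ler_norm.
  rewrite -[(- phi) t]/(- phi t) -[(- phi) 0]/(- phi 0); lra.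
apply: (H phi g) => // s st; apply: le_trans (gb s st); exact: ler_norm.
Qed.

(** * Picard iteration for bounded, locally Lipschitz fields *)

Lemma halving_lt (R : realType) (K e : R) : 0 <= K -> 0 < e ->
  exists n, K * 2^-1 ^+ n < e.
Proof.
move=> K0 e0; have : geometric K 2^-1 n @[n --> \oo] --> (0 : R).
  by apply: cvg_geometric; rewrite ger0_norm; lra.
move=> /cvgrPdist_lt/(_ e e0)[n _ /(_ n (leqnn n))] /=.
by rewrite sub0r normrN ger0_norm ?mulr_ge0 ?exprn_ge0 // => ne; exists n.
Qed.

(** The steps sum to a geometric series. *)
Lemma geometric_steps_cvg (R : realType) (N : nat) (u : nat -> 'rV[R]_N) (K : R) :
  (forall n, `|u n.+1 - u n| <= K * 2^-1 ^+ n) ->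
  u n @[n --> \oo] --> lim (u n @[n --> \oo]) /\
  forall n, `|lim (u n @[n --> \oo]) - u n| <= 2 * K * 2^-1 ^+ n.
Proof.
move=> Ku.
have K0 : 0 <= K by have := Ku 0; rewrite expr0 mulr1; exact: le_trans.
have dist n k : `|u (n + k)%N - u n| <= 2 * K * 2^-1 ^+ n.
  suff : `|u (n + k)%N - u n| <= 2 * K * (2^-1 ^+ n - 2^-1 ^+ (n + k)).
    move=> /le_trans; apply; rewrite ler_wpM2l ?mulr_ge0 // gerBl.
    by rewrite exprn_ge0.
  elim: k => [|k IH]; first by rewrite addn0 !subrr normr0 mulr0.
  rewrite addnS -(subrK (u (n + k)%N) (u (n + k).+1)) -addrA.
  rewrite (le_trans (ler_normD _ _)) // exprS.
  move: (Ku (n + k)%N) IH; lra.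
have cu : cvg (u n @[n --> \oo]).
  apply/cauchy_cvgP/cauchy_exP => e e0.
  have [n ne] := halving_lt (mulr_ge0 (ler0n R 2) K0) e0.
  exists (u n); suff : \forall p \near \oo, ball (u n) e (u p) by [].
  exists n => // p /= np; rewrite -ball_normE /= distrC -(subnKC np).
  exact: le_lt_trans (dist _ _) ne.
split=> // n; apply/ler_addgt0Pr => e e0.
have /cvgrPdist_le/(_ e e0)[p _ Hp] := cu.
rewrite -(subrK (u (n + p)%N) (lim _)) -addrA (le_trans (ler_normD _ _)) //.
rewrite [leRHS]addrC lerD // Hp //=; exact: leq_addl.
Qed.

Lemma is_derive_linear (R : realType) (k s : R) :
  is_derive s (1 : R) (fun r => k * r) k.
Proof.
have : is_derive s (1 : R) (k \*: id) (k *: 1) by exact: is_deriveZ.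
by rewrite scaler1.
Qed.

Lemma is_derive_exp_linear (R : realType) (c k s : R) :
  is_derive s (1 : R) (fun r => c * expR (k * r)) (c * (expR (k * s) * k)).
Proof.
have : is_derive s (1 : R) (expR \o (fun r => k * r)) (expR (k * s) * k).
  by apply: is_derive1_comp; exact: is_derive_linear.
by move=> dexp; exact: (is_deriveZ c dexp).
Qed.

Section picard.
Context (R : realType) (N : nat) (F : 'rV[R]_N -> 'rV[R]_N) (x0 : 'rV[R]_N).
Variable (U : R).
Hypothesis F_continuous : forall i, continuous (fun x => F x 0 i).
Hypothesis F_bounded : forall x i, `|F x 0 i| <= U.
Hypothesis F_lipschitz : forall r, exists2 L, 0 <= L &
  forall x y, `|x - x0| <= r -> `|y - x0| <= r ->
    forall i, `|F y 0 i - F x 0 i| <= L * `|y - x|.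
Hypothesis U0 : 0 <= U.

(** The integral operator is frozen at negative times, so that it acts on curves
    that are continuous on the whole line. *)
Definition picard_map (y : R -> 'rV[R]_N) (t : R) : 'rV[R]_N :=
  x0 + \row_i primitive (fun s => F (y s) 0 i) (Num.max t 0).

Lemma picard_map0 y : picard_map y 0 = x0.
Proof.
rewrite /picard_map maxxx; apply/rowP => i.
by rewrite !mxE primitive0 addr0.
Qed.

Lemma picard_map_max y t : picard_map y t = picard_map y (Num.max t 0).
Proof. by rewrite /picard_map -maxA maxxx. Qed.

Let field_along_continuous (y : R -> 'rV[R]_N) (i : 'I_N) :
  continuous y -> continuous (fun s => F (y s) 0 i).
Proof.
move=> cy s; apply: (@continuous_comp _ _ _ y (fun x => F x 0 i)); first exact: cy.
exact: F_continuous.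
Qed.

Lemma picard_map_coord y t i : 0 <= t ->
  picard_map y t 0 i = x0 0 i + primitive (fun s => F (y s) 0 i) t.
Proof. by move=> t0; rewrite /picard_map max_l // !mxE. Qed.

Lemma picard_map_continuous y : continuous y -> continuous (picard_map y).
Proof.
move=> cy t; apply: cvg_row => i.
have -> : (fun s => picard_map y s 0 i) =
    (fun s => x0 0 i + primitive (fun s => F (y s) 0 i) (Num.max s 0)).
  by apply/funext => s; rewrite !mxE.
rewrite !mxE; apply: cvgD; first exact: cvg_cst.
apply: (@continuous_comp _ _ _ (fun s : R => Num.max s 0) (primitive _)).
  by apply: continuous_max => //; exact: cvg_cst.
apply: is_derive_continuous; apply: primitive_is_derive.
  exact: field_along_continuous.
by rewrite le_max lexx orbT.
Qed.

Lemma picard_map_derive y (t : R) : continuous y -> 0 < t ->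
  is_derive t (1 : R) (picard_map y) (F (y t)).
Proof.
move=> cy t0; apply: is_derive_row => i.
have dp := primitive_is_derive (field_along_continuous (i := i) cy) (ltW t0).
have : is_derive t (1 : R) (cst (x0 0 i) + primitive (fun s => F (y s) 0 i)) (0 + F (y t) 0 i).
  exact: is_deriveD.
rewrite add0r; apply: near_eq_is_derive.
near=> s; rewrite picard_map_coord // ltW //.
by near: s; exact: lt_nbhsr.
Unshelve. all: by end_near. Qed.

Lemma picard_map_dist y1 y2 (B b : R -> R) (t : R) : continuous y1 -> continuous y2 ->
  0 <= t -> 0 <= B t - B 0 ->
  (forall s, 0 <= s <= t -> is_derive s (1 : R) B (b s)) ->
  (forall s i, 0 <= s <= t -> `|F (y1 s) 0 i - F (y2 s) 0 i| <= b s) ->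
  `|picard_map y1 t - picard_map y2 t| <= B t - B 0.
Proof.
move=> c1 c2 t0 B0 dB Hb; apply/row_norm_leP => // i.
rewrite mxE [X in _ + X]mxE !picard_map_coord // opprD addrACA subrr add0r.
pose phi := primitive (fun s => F (y1 s) 0 i) - primitive (fun s => F (y2 s) 0 i).
have -> : primitive (fun s => F (y1 s) 0 i) t - primitive (fun s => F (y2 s) 0 i) t
   = phi t - phi 0.
  by rewrite -[phi t]/(_ t - _ t) -[phi 0]/(_ 0 - _ 0) !primitive0 !subrr subr0.
apply: (norm_growth_le (g := fun s => F (y1 s) 0 i - F (y2 s) 0 i) (b := b)) => //.
- move=> s /andP[s0 _]; apply: is_deriveB; apply: primitive_is_derive => //;
   exact: field_along_continuous.
- by move=> s st; exact: Hb.
Qed.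

Lemma picard_map_bound y t : continuous y -> 0 <= t ->
  `|picard_map y t - x0| <= U * t.
Proof.
move=> cy t0; apply/row_norm_leP => [|i]; first exact: mulr_ge0.
rewrite mxE [X in _ + X]mxE picard_map_coord // addrAC subrr add0r.
have := @norm_growth_le R (primitive (fun s => F (y s) 0 i)) (fun s => F (y s) 0 i)
  (fun r => U * r) (cst U) t t0.
rewrite primitive0 mulr0 !subr0; apply.
- move=> s /andP[s0 _]; apply: primitive_is_derive => //.
  exact: field_along_continuous.
- by move=> s _; exact: is_derive_linear.
- by move=> s _; exact: F_bounded.
Qed.

Definition picard_iterate (n : nat) : R -> 'rV[R]_N := iter n picard_map (cst x0).

Lemma picard_iterate_continuous n : continuous (picard_iterate n).
Proof.
elim: n => [|n IH]; first exact: cst_continuous.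
exact: picard_map_continuous.
Qed.

Lemma picard_iterate_max n t : picard_iterate n t = picard_iterate n (Num.max t 0).
Proof. by case: n => [//|n]; exact: picard_map_max. Qed.

Lemma picard_iterate_bound n t : 0 <= t -> `|picard_iterate n t - x0| <= U * t.
Proof.
case: n => [|n] t0; first by rewrite /= subrr normr0 mulr_ge0.
by apply: picard_map_bound => //; exact: picard_iterate_continuous.
Qed.

(** Weighting by [expR (2 * L * t)] turns the Picard operator into a contraction
    by 1/2 on the whole interval: integrating [L * expR (2 * L * s)] gives at most
    [expR (2 * L * t) / 2]. *)
Lemma picard_iterate_step (T : R) : exists2 L, 0 <= L & forall n t, 0 <= t <= T ->
  `|picard_iterate n.+1 t - picard_iterate n t| <=
    U * T * 2^-1 ^+ n * expR (2 * L * t).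
Proof.
have [L L0 HL] := F_lipschitz (U * T).
exists L => //; elim=> [|n IH] t /andP[t0 tT].
  rewrite expr0 mulr1 (le_trans (picard_iterate_bound 1 t0)) //.
  rewrite (le_trans (ler_wpM2l U0 tT)) //.
  have e1 : 1 <= expR (2 * L * t).
    by apply: le_trans (expR_ge1Dx _); rewrite lerDl !mulr_ge0.
  by rewrite ler_peMr // mulr_ge0 // (le_trans t0).
set c := U * T * 2^-1 ^+ n.+1.
have T0 : 0 <= T by exact: le_trans tT.
have c0 : 0 <= c by rewrite !mulr_ge0 ?exprn_ge0.
have E0 : expR (2 * L * 0) <= expR (2 * L * t).
  by rewrite ler_expR ler_wpM2l // mulr_ge0.
have := @picard_map_dist (picard_iterate n.+1) (picard_iterate n)
  (fun r => c * expR (2 * L * r)) (fun s => c * (expR (2 * L * s) * (2 * L))) t.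
move=> /(_ (@picard_iterate_continuous _) (@picard_iterate_continuous _) t0) D.
apply: le_trans (D _ _ _) _.
- by rewrite subr_ge0 ler_wpM2l.
- by move=> s _; exact: is_derive_exp_linear.
- move=> s i /andP[s0 st].
  have sT : 0 <= s <= T by rewrite s0 (le_trans st).
  have inball k : `|picard_iterate k s - x0| <= U * T.
    by rewrite (le_trans (picard_iterate_bound k s0)) // ler_wpM2l //; case/andP: sT.
  rewrite (le_trans (HL _ _ (inball _) (inball _) i)) //.
  rewrite (le_trans (ler_wpM2l L0 (IH s sT))) // /c exprS.
  by rewrite le_eqVlt; apply/orP; left; apply/eqP; field.
- by rewrite gerBl mulr_ge0 // expR_ge0.
Qed.

Definition picard_limit (t : R) : 'rV[R]_N :=
  lim (picard_iterate n t @[n --> \oo]).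

Lemma picard_limit_max t : picard_limit t = picard_limit (Num.max t 0).
Proof.
by rewrite /picard_limit; under eq_fun do rewrite picard_iterate_max.
Qed.

Lemma picard_limit_dist (T : R) : 0 <= T -> exists2 K, 0 <= K &
  forall n t, t <= T -> `|picard_limit t - picard_iterate n t| <= K * 2^-1 ^+ n.
Proof.
move=> T0; have [L L0 HL] := picard_iterate_step T.
pose K := U * T * expR (2 * L * T).
exists (2 * K) => [|n t tT]; first by rewrite !mulr_ge0 // expR_ge0.
apply: (geometric_steps_cvg (u := fun n => picard_iterate n t) _).2 => {}n.
rewrite !(picard_iterate_max _ t).
have mT : 0 <= Num.max t 0 <= T by rewrite le_max lexx orbT ge_max tT.
rewrite (le_trans (HL _ _ mT)) // /K mulrAC ler_wpM2r ?exprn_ge0 //.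
rewrite ler_wpM2l ?mulr_ge0 // ler_expR ler_wpM2l ?mulr_ge0 //.
by case/andP: mT.
Qed.

Lemma picard_limit_continuous : continuous picard_limit.
Proof.
move=> t; have T0 : 0 <= `|t| + 1 by rewrite addr_ge0.
have [K K0 HK] := picard_limit_dist T0.
apply/cvgrPdist_lt => e e0.
have [n Hn] := halving_lt K0 (divr_gt0 e0 (ltr0Sn R 2)).
have /cvgrPdist_lt/(_ _ (divr_gt0 e0 (ltr0Sn R 2))) := @picard_iterate_continuous n t.
have tT : t < `|t| + 1 by rewrite ltr_pwDr // ler_norm.
apply: filterS2 (lt_nbhsl tT) => s sT ts.
have := HK n t (ltW tT); have := HK n s (ltW sT).
rewrite -[picard_limit s - _]opprB normrN.
have -> : picard_limit t - picard_limit s =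
  (picard_limit t - picard_iterate n t) + (picard_iterate n t - picard_iterate n s)
  + (picard_iterate n s - picard_limit s).
  by rewrite !addrA !subrK.
move=> ds dt; rewrite (le_lt_trans (ler_normD _ _)) //.
have := ler_normD (picard_limit t - picard_iterate n t)
  (picard_iterate n t - picard_iterate n s).
lra.
Qed.

(** The Picard map sends the [n]-th iterate to the next one and is Lipschitz on
    the ball containing the iterates and their limit, so the limit is within a
    constant times [2^-1 ^+ n] of its image, for every [n]. *)
Lemma picard_limit_fixed : picard_map picard_limit = picard_limit.
Proof.
have fixed t : 0 <= t -> picard_map picard_limit t = picard_limit t.
  move=> t0; have [K K0 HK] := picard_limit_dist t0.
  have [L L0 HL] := F_lipschitz (U * t + K).
  apply/eqP; rewrite -subr_eq0 -normr_le0; apply/ler_addgt0Pr => e e0; rewrite add0r.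
  have M0 : 0 <= L * K * t + K by rewrite addr_ge0 ?mulr_ge0.
  have [n Hn] := halving_lt M0 e0.
  pose k := L * (K * 2^-1 ^+ n).
  have k0 : 0 <= k by rewrite !mulr_ge0 // exprn_ge0.
  have := @picard_map_dist picard_limit (picard_iterate n) (fun r => k * r) (cst k) t.
  move=> /(_ picard_limit_continuous (@picard_iterate_continuous n) t0).
  rewrite mulr0 subr0 => D.
  have {D} D : `|picard_map picard_limit t - picard_iterate n.+1 t| <= k * t.
    apply: D; first exact: mulr_ge0.
      by move=> s _; exact: is_derive_linear.
    move=> s i /andP[s0 st].
    have Us : `|picard_iterate n s - x0| <= U * t + K.
      rewrite (le_trans (picard_iterate_bound n s0)) //.
      by rewrite (le_trans (ler_wpM2l U0 st)) // lerDl.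
    have Ks : `|picard_limit s - x0| <= U * t + K.
      rewrite (le_trans (HK 0%N s st)) // expr0 mulr1 lerDr mulr_ge0 //.
    rewrite (le_trans (HL _ _ Us Ks i)) // ler_wpM2l //; exact: HK.
  have := HK n.+1 t (lexx t); rewrite -normrN opprB => D'.
  rewrite -(subrK (picard_iterate n.+1 t) (picard_map _ _)) -addrA.
  rewrite (le_trans (ler_normD _ _)) //.
  have : K * 2^-1 ^+ n.+1 <= K * 2^-1 ^+ n.
    by rewrite ler_wpM2l // exprS ger_pMl ?exprn_gt0 //; lra.
  move: D D' Hn; rewrite /k; lra.
apply/funext => t; rewrite picard_map_max fixed -?picard_limit_max //.
by rewrite le_max lexx orbT.
Qed.

(** The limit of the Picard iterates is its own Picard image, and therefore
    differentiable. *)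
Lemma bounded_lipschitz_solution : exists2 x, solution F x & x 0 = x0.
Proof.
exists picard_limit; last by rewrite -picard_limit_fixed picard_map0.
split; first exact/continuous_subspaceT/picard_limit_continuous.
move=> t t0; rewrite -{1}picard_limit_fixed.
by apply: picard_map_derive => //; exact: picard_limit_continuous.
Qed.

End picard.

(** * The saturated gradient play *)

Lemma saturation_continuous (R : realType) (U : R) :
  0 < U -> continuous (saturation U).
Proof.
move=> U0 a; apply/cvgrPdist_le => e e0.
near=> b; rewrite (le_trans (saturation_lipschitz b a U0)) //.
Unshelve. all: by end_near. Qed.

Lemma saturated_field_solution (R : realType) (N : nat) (U : R)
    (P : 'rV[R]_N -> 'rV[R]_N) (x0 : 'rV[R]_N) :
  0 < U -> (forall i, class_C 1 (fun x => P x 0 i)) ->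
  exists2 x, solution (saturated_field U P) x & x 0 = x0.
Proof.
move=> U0 P1.
apply: (@bounded_lipschitz_solution _ _ _ x0 U) => [i|x i|r|]; last exact: ltW.
- have -> : (fun x => saturated_field U P x 0 i) =
      (fun x => - saturation U (P x 0 i)).
    by apply/funext => x; rewrite mxE.
  move=> x; apply: (@continuous_comp _ _ _ (fun x => P x 0 i)
    (fun s => - saturation U s)); first exact: (P1 i).1.
  by apply: cvgN; exact: saturation_continuous.
- by rewrite mxE normrN saturation_le.
have /choice[K HK] i : exists K, 0 <= K /\ forall x y, `|x - x0| <= r ->
    `|y - x0| <= r -> `|P y 0 i - P x 0 i| <= K * `|y - x|.
  by have [K K0 HK] := C1_lipschitz x0 r (P1 i); exists K.
exists (\sum_i K i); first by apply: sumr_ge0 => i _; exact: (HK i).1.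
move=> x y xr yr i; rewrite !mxE -opprD normrN.
rewrite (le_trans (saturation_lipschitz _ _ U0)) //.
rewrite (le_trans ((HK i).2 x y xr yr)) // ler_wpM2r //.
rewrite (bigD1 i) //= lerDl sumr_ge0 // => j _; exact: (HK j).1.
Qed.

Theorem theorem1 (R : realType) (N : nat) (f : 'I_N -> 'rV[R]_N -> R) (U : R)
    (hC2 : forall i : 'I_N, class_C 2 (f i))
    (hmono : exists2 m : R, 0 < m &
      forall x z : 'rV[R]_N,
        dot (x - z) (pseudo_gradient f x - pseudo_gradient f z) >=
          m * enorm (x - z) ^+ 2)
    (hU : 0 < U) :
  exists xs : 'rV[R]_N,
    unique (nash_equilibrium f) xs /\
    globally_asymptotically_stable (saturated_gradient_play U f) xs.
Proof.
have [m m0 hm] := hmono; pose P := pseudo_gradient f.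
have mono : strongly_monotone m P.
  by move=> x z; rewrite -enorm_sqr; exact: hm.
have f1 i : class_C 1 (f i).
  have [cf df] := hC2 i; split=> // j; have [dfj [cfj _]] := df j.
  by split.
have P1 i : class_C 1 (fun x => P x 0 i).
  have -> : (fun x => P x 0 i) = partial i (f i) by apply/funext => x; rewrite mxE.
  exact: ((hC2 i).2 i).2.
have sol x0 := saturated_field_solution x0 hU P1.
have nashE x := nash_equilibrium_zero x m0 f1 mono.
have [x sx _] := sol 0.
have [xs Pxs] := zero_of_trajectory m0 hU P1 mono sx.
exists xs; split.
  split; first exact/nashE.
  move=> z /nashE Pz; apply/eqP; rewrite -subr_eq0 -normr_le0.
  have := strongly_monotone_expansive xs z m0 mono.
  rewrite Pxs [P z]Pz subrr -enorm_sqr [dot 0 0]dotE big1; last first.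
    by move=> i _; rewrite mxE mul0r.
  rewrite pmulr_rle0 ?exprn_gt0 // => d0.
  rewrite (le_trans (norm_le_enorm _)) // -(@ler_pXn2r _ 2) ?nnegrE ?sqrtr_ge0 //.
  by rewrite expr0n.
split.
- apply/rowP => i; rewrite mxE [pseudo_gradient f xs]Pxs !mxE.
  by rewrite /saturation sgr0 mul0r oppr0.
- exact: sol.
- exact: zero_lyapunov_stable m0 hU P1 mono _ Pxs.
- by move=> y sy; exact: trajectory_cvg_zero m0 hU P1 mono y xs sy Pxs.
Qed.
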